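(* Let $\lambda$ be a partition, $n\in N(\lambda)$, $k\ge 1$, and $x_k=(x_1,\dots,x_k)$. Then \[\mathrm{ss}_{\lambda,n}(x_1,\dots,x_k)=\sum_{Q\in\mathrm{QYOT}_{\le k,n}(\lambda)}F_{\mathrm{des}\,Q}(x_1,\dots,x_k),\] and moreover each $F_{\mathrm{des}\,Q}(x_1,\dots,x_k)$ appearing in this sum is nonzero.
   Context: Partitions are Young diagrams (English convention); a box is a position $(i,j)$, $i$ = row, $j$ = column. For boxes $B_1=(i_1,j_1)$, $B_2=(i_2,j_2)$ write $B_1<_{nE}B_2$ if $i_1\ge i_2$ and $j_1<j_2$. A skew shape is a horizontal strip if it has at most one box in each column. $N(\lambda)=\{n\ge|\lambda|: n\equiv|\lambda|\pmod 2\}$. For a strong composition $b=(b_1,\dots,b_l)$, $M_b(x)=\sum_{i_1<\dots<i_l}x_{i_1}^{b_1}\cdots x_{i_l}^{b_l}$; for a strong composition $a$, $F_a=\sum_b M_b$ over all strong compositions $b$ obtained from $a$ by splitting each part, in order, into positive parts with the same sum (including $b=a$). $F_a(x_1,\dots,x_k)$ is its specialization $x_{k+1}=x_{k+2}=\dots=0$. For partitions write $\nu\lhd\mu$ if $\nu\subset\mu$, $|\mu|=|\nu|+1$. An OT of length $n$ is $O=(O_0,\dots,O_n)$ of partitions with $O_0=\emptyset$ and for each $j\in[n]$ either $O_{j-1}\lhd O_j$ ($j$ an addition) or $O_j\lhd O_{j-1}$ ($j$ a deletion); $B_j$ is the box where $O_{j-1},O_j$ differ. Descent composition: split $\{1,\dots,n\}$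 into consecutive blocks, where $1$ starts a block and, for $2\le j\le n$, $j$ is in the same block as $j-1$ iff (a) $j-1,j$ are both additions and $B_{j-1}<_{nE}B_j$, or (b) both are deletions and $B_j<_{nE}B_{j-1}$, or (c) $j-1$ is a deletion and $j$ an addition; $\mathrm{des}\,O$ is the sequence of block lengths. An SSOT of shape $\lambda$ is a sequence of partitions $S=(S^1,S'^2,S^2,S'^3,\dots)$ such that, with $S^0=S'^1=\emptyset$: for all $i\ge1$, $S'^i\subseteq S^{i-1}$, $S'^i\subseteq S^i$, and $S^{i-1}/S'^i$, $S^i/S'^i$ are horizontal strips (possibly empty); and $S^i=S'^{i+1}=\lambda$ for all large $i$. Put $m_i(S)=|S^{i-1}/S'^i|+|S^i/S'^i|$, length $n=\sum_im_i(S)$, weight $\mathrm{wt}(S)=(m_1(S),m_2(S),\dots)$ (trailing zeros ignored), $x^S=\prod_ix_i^{m_i(S)}$, and $\mathrm{step}(S)$ = the largest $i$ with $m_i(S)>0$ ($0$ if none). $\mathrm{ss}_{\lambda,n}(x)=\sum x^S$ over SSOTs of shape $\lambda$ and length $n$, and $\mathrm{ss}_{\lambda,n}(x_1,\dots,x_k)$ its specialization $x_{k+1}=\dots=0$. The standardization $\mathrm{std}\,S$ is the OT obtained from $\emptyset$ by, for $i=1,2,\dots$, first removing the boxes of $S^{i-1}/S'^i$ one by one from right to left, then adding the boxes of $S^i/S'^i$ one by one from left to right; $\mathrm{des}\,S:=\mathrm{des}(\mathrm{std}\,S)$. An SSOT $Q$ is quasi-Yamanouchi if $\mathrm{wt}(Q)=\mathrm{des}\,Q$.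 $\mathrm{QYOT}_{\le k,n}(\lambda)$ is the set of quasi-Yamanouchi SSOTs of shape $\lambda$, length $n$ and step at most $k$. *)

(* Defs.v *)
From HB Require Import structures.
From mathcomp Require Import all_boot all_order all_algebra finmap.
From mathcomp Require Import boolp classical_sets functions cardinality fsbigop.
From mathcomp Require Import mpoly.

Set Implicit Arguments.
Unset Strict Implicit.
Unset Printing Implicit Defensive.

Import GRing.Theory.

Local Open Scope classical_set_scope.
Local Open Scope fset_scope.
Local Open Scope ring_scope.

(* A box is a pair (row, column), with rows growing downwards. Coordinates
   start at 0: only comparisons between coordinates are ever used. *)
Definition box : Type := (nat * nat)%type.

Definition nE (b c : box) : bool := ((c.1 <= b.1) && (b.2 < c.2))%N.

Definition diagram : Type := {fset box}.

Definition is_partition (D : diagram) : Prop :=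
  forall i j i' j' : nat,
    (i, j) \in D -> (i' <= i)%N -> (j' <= j)%N -> (i', j') \in D.

Definition horizontal_strip (D : diagram) : Prop :=
  {in D &, injective (fun b : box => b.2)}.

(** Quasisymmetric functions *)

(* The series below are written for an arbitrary family of values
   x_1, x_2, ... in a commutative ring (x 0 is never used). The sums are
   finitely supported, hence meaningful, as soon as x i = 0 for all large i. *)

Definition M (R : comNzRingType) (x : nat -> R) (b : seq nat) : R :=
  \sum_(i \in [set i : (size b).-tuple nat | path ltn 0%N i])
     \prod_(j < size b) x (tnth i j) ^+ nth 0%N b j.

Definition splits (a b : seq nat) : Prop :=
  exists bs : seq (seq nat),
    [/\ b = flatten bs, a = map sumn bs & 0%N \notin b].

Definition F (R : comNzRingType) (x : nat -> R) (a : seq nat) : R :=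
  \sum_(b \in [set b : seq nat | splits a b]) M x b.

(* The specialization x_{k+1} = x_{k+2} = ... = 0. The variables of
   {mpoly int[k]} are numbered from 0, so that x_i is 'X_(i-1). *)
Definition xvar (k i : nat) : {mpoly int[k]} :=
  if i is i'.+1 then
    if insub i' is Some j then 'X_(j : 'I_k) else 0
  else 0.

(** Oscillating tableaux and their descent compositions *)

Definition covers (nu mu : diagram) : bool :=
  (nu `<=` mu) && (#|` mu| == #|` nu|.+1).

Definition is_OT (O : seq diagram) : Prop :=
  [/\ (0 < size O)%N, nth fset0 O 0 = fset0,
      (forall j, (j < size O)%N -> is_partition (nth fset0 O j))
    & (forall j, (0 < j < size O)%N ->
         covers (nth fset0 O j.-1) (nth fset0 O j)
         || covers (nth fset0 O j) (nth fset0 O j.-1))].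

Section Descents.
Variable O : seq diagram.

Definition addition (j : nat) : bool :=
  covers (nth fset0 O j.-1) (nth fset0 O j).

Definition deletion (j : nat) : bool :=
  covers (nth fset0 O j) (nth fset0 O j.-1).

(* The symmetric difference is a singleton when O is an oscillating tableau. *)
Definition step_box (j : nat) : box :=
  let D := nth fset0 O j.-1 in let E := nth fset0 O j in
  head (0, 0)%N (enum_fset ((D `\` E) `|` (E `\` D))).

Definition same_block (j : nat) : bool :=
  [|| [&& addition j.-1, addition j & nE (step_box j.-1) (step_box j)],
      [&& deletion j.-1, deletion j & nE (step_box j) (step_box j.-1)]
    | deletion j.-1 && addition j].

End Descents.

(* Lengths of the consecutive blocks, where c is the length so far of the
   current block and s tells, for each later index, whether it stays in the
   block of its predecessor. *)
Fixpoint block_lengths (c : nat) (s : seq bool) : seq nat :=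
  if s is t :: s' then
    if t then block_lengths c.+1 s' else c :: block_lengths 1 s'
  else [:: c].

Definition des (O : seq diagram) : seq nat :=
  let n := (size O).-1 in
  if n == 0%N then [::]
  else block_lengths 1 [seq same_block O j | j <- iota 2 n.-1].

(** Semistandard oscillating tableaux *)

(* The term of index i is the pair (S'^i, S^i). There is no S'^0: it is set
   to the empty diagram so that each tableau has a unique encoding. *)
Definition tableau : Type := nat -> diagram * diagram.

Section Tableau.
Variable S : tableau.

(* For i >= 1; both skew shapes are empty at i = 0 in a tableau. *)
Definition removed (i : nat) : diagram := (S i.-1).2 `\` (S i).1.
Definition added (i : nat) : diagram := (S i).2 `\` (S i).1.

Definition is_SSOT (lambda : diagram) : Prop :=
  [/\ [/\ (S 0%N).1 = fset0, (S 0%N).2 = fset0 & (S 1%N).1 = fset0],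
      (forall i, is_partition (S i).1 /\ is_partition (S i).2),
      (forall i, (0 < i)%N ->
         [/\ (S i).1 `<=` (S i.-1).2, (S i).1 `<=` (S i).2,
             horizontal_strip (removed i) & horizontal_strip (added i)])
    & (exists N, forall i, (N <= i)%N ->
         (S i).2 = lambda /\ (S i.+1).1 = lambda)].

Definition mult (i : nat) : nat := (#|` removed i| + #|` added i|)%N.

Definition length : nat := \big[addn/0%N]_(i \in [set: nat]) mult i.

Definition step : nat :=
  \big[maxn/0%N]_(i \in [set i : nat | (0 < mult i)%N]) i.

Definition monomial (R : comNzRingType) (x : nat -> R) : R :=
  \big[*%R/1]_(i \in [set: nat]) x i ^+ mult i.

Definition left_to_right (D : diagram) : seq box :=
  sort (fun b c : box => (b.2 <= c.2)%N) (enum_fset D).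

Definition std : seq diagram :=
  fset0 :: flatten
    [seq scanl (fun D b => D `\ b) (S i.-1).2 (rev (left_to_right (removed i)))
         ++ scanl (fun D b => b |` D) (S i).1 (left_to_right (added i))
    | i <- iota 1 step].

Definition quasi_Yamanouchi : Prop :=
  forall i, mult i.+1 = nth 0%N (des std) i.

End Tableau.

Definition SSOT (lambda : diagram) (n : nat) : set tableau :=
  [set S | is_SSOT S lambda /\ length S = n].

Definition ss (R : comNzRingType) (x : nat -> R) (lambda : diagram) (n : nat) :=
  \sum_(S \in SSOT lambda n) monomial S x.

Definition QYOT (k n : nat) (lambda : diagram) : set tableau :=
  [set Q | [/\ SSOT lambda n Q, quasi_Yamanouchi Q & (step Q <= k)%N]].

(* Main.v *)
(* Standardization splits a tableau S into the oscillating tableau O = std S and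
   the weight w = wt S, and S is recovered from O and w: S^i is O at time
   w_1 + ... + w_i, and S'^i is the lowest diagram met while reading the i-th
   block of O. A weight w arises from O exactly when each block is a run of steps
   satisfying (a), (b) or (c), that is, when the nonzero parts of w split des O.
   Summing x^w over these w, grouped by the composition b of their nonzero parts,
   gives the monomials of the M_b with b splitting des O, that is, F_{des O}.
   Finally, the quasi-Yamanouchi tableaux are those with w = des O, so they index
   the O that occur; having the fewest parts, they have step at most k as soon as
   one tableau standardizing to O has. *)

Require Import Defs.
From mathcomp Require Import all_boot all_order all_algebra finmap.
From mathcomp Require Import boolp classical_sets functions cardinality fsbigop.
From mathcomp Require Import mpoly.
From mathcomp Require Import zify.

Local Open Scope classical_set_scope.
Local Open Scope fset_scope.
Local Open Scope ring_scope.

Set Implicit Arguments.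
Unset Strict Implicit.
Unset Printing Implicit Defensive.
Import GRing.Theory.

(** * Horizontal strips *)

Section Strips.
Local Open Scope nat_scope.

(** The body of [step_box] with the diagrams as arguments, so that [same_block] unfolds by
    conversion to a condition on three diagrams. *)
Definition diff_box (D E : diagram) : box :=
  head (0, 0) (enum_fset ((D `\` E) `|` (E `\` D))).

Lemma diff_boxC D E : diff_box D E = diff_box E D.
Proof. by rewrite /diff_box fsetUC. Qed.

Lemma diff_box_add (D : diagram) b : b \notin D -> diff_box D (b |` D) = b.
Proof.
move=> bD; rewrite /diff_box; suff -> : (D `\` (b |` D)) `|` ((b |` D) `\` D) = [fset b].
  have : forall x, (x \in enum_fset [fset b]) = (x == b) by move=> x; exact: in_fset1.
  case: (enum_fset _) => [/(_ b)|c s /(_ c)] /=; first by rewrite inE eqxx.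
  by rewrite inE eqxx => /esym /eqP.
apply/fsetP=> x; rewrite !inE; have [->|] := eqVneq x b; first by rewrite bD.
by move=> _; case: (x \in D).
Qed.

Lemma covers_add (D : diagram) b : b \notin D -> covers D (b |` D).
Proof. by move=> bD; rewrite /covers fsubsetUr cardfsU1 bD /=. Qed.

Lemma coversE D E : covers D E ->
  diff_box D E \notin D /\ E = diff_box D E |` D.
Proof.
case/andP=> sDE /eqP cE.
have : #|` E `\` D| == 1 by rewrite cardfsDS // cE subSnn.
case/cardfs1P=> b Eb.
have EbD : E = b |` D by rewrite -Eb fsetUDr fsetDv fsetD0 fsetUC (fsetUidPr _ _ sDE).
have bD : b \notin D by have := fset11 b; rewrite -Eb inE => /andP[].
by rewrite EbD diff_box_add.
Qed.

Lemma covers_asym D E : covers D E -> covers E D = false.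
Proof. by rewrite /covers => /andP[_ /eqP->]; apply/negP=> /andP[_ /eqP]; lia. Qed.

(** Describes both halves of a block: the additions in order, the deletions in reverse. *)
Definition fill (E : diagram) (l : seq box) (t : nat) : diagram :=
  [fset b in take t l] `|` E.

Lemma in_fill E l t b : (b \in fill E l t) = (b \in take t l) || (b \in E).
Proof. by rewrite /fill !inE. Qed.

Lemma fill0 E l : fill E l 0 = E.
Proof. by apply/fsetP=> b; rewrite in_fill take0. Qed.

Lemma fillS E l t : t < size l -> fill E l t.+1 = nth (0, 0) l t |` fill E l t.
Proof.
move=> tl; apply/fsetP=> b.
by rewrite in_fset1U !in_fill (take_nth (0, 0)) // mem_rcons in_cons orbA.
Qed.

Lemma mem_left_to_right D : left_to_right D =i D.
Proof. by move=> b; rewrite mem_sort. Qed.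

Lemma left_to_right_uniq D : uniq (left_to_right D).
Proof. by rewrite sort_uniq fset_uniq. Qed.

Lemma size_left_to_right D : size (left_to_right D) = #|` D|.
Proof. exact: size_sort. Qed.

Lemma left_to_right_sorted D : horizontal_strip D ->
  sorted ltn [seq b.2 | b <- left_to_right D].
Proof.
move=> hD; rewrite ltn_sorted_uniq_leq map_inj_in_uniq; last first.
  by move=> b c; rewrite !mem_left_to_right; apply: hD.
by rewrite left_to_right_uniq sorted_map sort_sorted // => b c; apply: leq_total.
Qed.

(** Strictly increasing columns leave no two boxes in one column, and a strictly sorted list is
    determined by its members. *)
Lemma sorted_left_to_right (D : diagram) l : l =i D ->
    sorted ltn [seq b.2 | b <- l] ->
  horizontal_strip D /\ left_to_right D = l.
Proof.
move=> lD sl; have hD : horizontal_strip D.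
  have := sl; rewrite ltn_sorted_uniq_leq => /andP[ul _] b c /=.
  rewrite -!lD => bl cl /= e.
  rewrite -(nth_index (0, 0) bl) -(nth_index (0, 0) cl); congr nth.
  apply/eqP; rewrite -(nth_uniq 0 _ _ ul) ?size_map ?index_mem //.
  by rewrite !(nth_map (0, 0)) ?index_mem // !nth_index // e.
split=> //; have := left_to_right_sorted hD; move: sl; rewrite !sorted_map => sl sD.
apply: (irr_sorted_eq _ _ sD sl) => [c b d|b|b] /=; [exact: ltn_trans|exact: ltnn|].
by rewrite mem_left_to_right lD.
Qed.

(** Each box added lies to the right of the previous one, so the columns increase strictly: the
    boxes form a horizontal strip, listed from left to right. *)
Lemma chain_fill (h : nat -> diagram) p :
    (forall t, t < p -> covers (h t) (h t.+1)) ->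
    (forall t, t.+1 < p ->
       nE (diff_box (h t) (h t.+1)) (diff_box (h t.+1) (h t.+2))) ->
  let l := left_to_right (h p `\` h 0) in
  [/\ h 0 `<=` h p, horizontal_strip (h p `\` h 0), size l = p
    & forall t, t <= p -> h t = fill (h 0) l t].
Proof.
move=> hc hn; pose l := mkseq (fun t => diff_box (h t) (h t.+1)) p.
have sz : size l = p by rewrite size_mkseq.
have hf t : t <= p -> h t = fill (h 0) l t.
  elim: t => [|t IH] tp; first by rewrite fill0.
  by rewrite fillS ?sz // nth_mkseq // -IH ?(ltnW tp) //; case: (coversE (hc t tp)).
have l0 b : b \in l -> b \notin h 0.
  case/(nthP (0, 0))=> t; rewrite sz => tp <-; rewrite nth_mkseq //.
  apply: contra (proj1 (coversE (hc t tp))).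
  by rewrite (hf t (ltnW tp)) in_fill => ->; rewrite orbT.
have hp b : (b \in h p) = (b \in l) || (b \in h 0).
  by rewrite (hf p (leqnn p)) in_fill take_oversize ?sz.
have lD : l =i h p `\` h 0.
  by move=> b; rewrite inE hp; have := l0 b; case: (b \in l) => [->|_] //; case: (b \in h 0).
have sl : sorted ltn [seq b.2 | b <- l].
  apply/(sortedP 0)=> t; rewrite size_map sz => tp.
  by rewrite !(nth_map (0, 0)) ?sz ?nth_mkseq ?(ltnW tp) //; case/andP: (hn t tp).
have [hD ->] := sorted_left_to_right lD sl.
by split=> //; apply/fsubsetP=> b; rewrite hp orbC => ->.
Qed.

(** * Filling a horizontal strip between two partitions, box by box *)

Section Fill.
Variables E A : diagram.
Hypotheses (pE : is_partition E) (pA : is_partition A) (sEA : E `<=` A).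
Hypothesis hA : horizontal_strip (A `\` E).
Let l := left_to_right (A `\` E).

Lemma mem_strip b : (b \in l) = (b \notin E) && (b \in A).
Proof. by rewrite mem_left_to_right inE. Qed.

Lemma fill_size : fill E l (size l) = A.
Proof.
apply/fsetP=> b; rewrite in_fill take_size mem_strip.
by have := fsubsetP sEA b; case: (b \in E) => [->|_] //=; rewrite orbF.
Qed.

(** If the next box [c] lay strictly below [b], the box in the row of [b] and the column of [c]
    would be in [A], being above [c], and outside [E], being right of [b]: two boxes of the strip in
    one column. *)
Lemma strip_nE t : t.+1 < size l -> nE (nth (0, 0) l t) (nth (0, 0) l t.+1).
Proof.
move=> tl; have := left_to_right_sorted hA; move/(sortedP 0)/(_ t).
rewrite size_map => /(_ tl); rewrite !(nth_map (0, 0)) ?(ltnW tl) //.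
have := mem_nth (0, 0) tl; have := mem_nth (0, 0) (ltnW tl).
rewrite -/l; set b := nth _ l t; set c := nth _ l t.+1.
rewrite !mem_strip /nE => /andP[bE bA] /andP[cE cA] /= bc; rewrite bc andbT leqNgt.
apply/negP=> rbc; have eA : (b.1, c.2) \in A.
  by case: (c) cA rbc => c1 c2 /= cA rbc; apply: pA cA _ _ => //; apply: ltnW.
have eE : (b.1, c.2) \notin E.
  apply: contra bE; case: (b) bc => b1 b2 /= bc eE; exact: pE eE _ (ltnW bc).
have /(_ (b.1, c.2) c) := hA; rewrite !inE eA eE cE cA => /(_ isT isT erefl) ec.
by move: rbc; rewrite -ec ltnn.
Qed.

(** A box weakly north-west of a filled one is in [E] or in the strip; in the strip, its column is
    no further right, so it is filled no later. *)
Lemma fill_partition t : is_partition (fill E l t).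
Proof.
move=> i j i' j' + ii jj; rewrite !in_fill.
case/orP=> [bt|bE]; last by rewrite (pE bE ii jj) orbT.
have bl := mem_take bt; move: (bl); rewrite mem_strip => /andP[bE bA].
have [|cE] := boolP ((i', j') \in E); first by rewrite orbT.
have cl : (i', j') \in l by rewrite mem_strip cE (pA bA ii jj).
rewrite orbF.
have st : sorted ltn [seq b.2 | b <- l] by apply: left_to_right_sorted.
have ib : index (i, j) l < t by rewrite -(in_take _ bl).
rewrite in_take //; apply: leq_ltn_trans ib; rewrite leqNgt; apply/negP=> lt.
have := sorted_ltn_nth ltn_trans 0 st.
move=> /(_ (index (i, j) l) (index (i', j') l)).
rewrite !inE size_map !index_mem => /(_ bl cl lt).
by rewrite !(nth_map (0, 0)) ?index_mem // !nth_index //=; lia.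
Qed.

Lemma fill_notin t : t < size l -> nth (0, 0) l t \notin fill E l t.
Proof.
move=> tl; rewrite in_fill negb_or in_take ?mem_nth //.
rewrite index_uniq // ?ltnn ?left_to_right_uniq //=.
by have := mem_nth (0, 0) tl; rewrite mem_strip => /andP[].
Qed.

Lemma fill_covers t : t < size l -> covers (fill E l t) (fill E l t.+1).
Proof. by move=> tl; rewrite fillS // covers_add // fill_notin. Qed.

Lemma fill_diff_box t : t < size l ->
  diff_box (fill E l t) (fill E l t.+1) = nth (0, 0) l t.
Proof. by move=> tl; rewrite fillS // diff_box_add // fill_notin. Qed.

End Fill.

(** The contribution of one index to [std]. As [scanl] omits its initial value, [A] itself is not
    listed, whence the prefix [A ::] below. *)
Definition block (A E C : diagram) : seq diagram :=
  scanl (fun D b => D `\ b) A (rev (left_to_right (A `\` E)))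
    ++ scanl (fun D b => b |` D) E (left_to_right (C `\` E)).

Lemma size_block A E C : size (block A E C) = #|` A `\` E| + #|` C `\` E|.
Proof. by rewrite size_cat !size_scanl size_rev !size_left_to_right. Qed.

Lemma in_foldl_remove (s : seq box) (D : diagram) b :
  (b \in foldl (fun D b => D `\ b) D s) = (b \notin s) && (b \in D).
Proof.
elim: s D => //= c s IH D; rewrite IH !inE negb_or.
by rewrite andbA [in LHS](andbC (b \notin s)).
Qed.

Lemma in_foldl_add (s : seq box) (D : diagram) b :
  (b \in foldl (fun D b => b |` D) D s) = (b \in s) || (b \in D).
Proof. by elim: s D => //= c s IH D; rewrite IH !inE orbCA orbA. Qed.

(** Removing the [t] rightmost boxes leaves the leftmost ones, so the deletions run through the
    filling backwards. *)
Lemma nth_block_remove A E C t : E `<=` A -> t <= #|` A `\` E| ->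
  nth fset0 (A :: block A E C) t
    = fill E (left_to_right (A `\` E)) (#|` A `\` E| - t).
Proof.
move=> sEA tr; set l := left_to_right (A `\` E).
rewrite /block -cat_cons nth_cat /= size_scanl size_rev size_left_to_right ltnS tr.
rewrite nth_cons_scanl ?size_rev ?size_left_to_right //.
apply/fsetP=> b; rewrite in_foldl_remove in_fill take_rev mem_rev size_left_to_right.
set k := (_ - t).
have : uniq l := left_to_right_uniq _.
have : (b \in l) = (b \notin E) && (b \in A) := mem_strip E A b.
rewrite -{1 2}(cat_take_drop k l) cat_uniq mem_cat.
case/boolP: (b \in E) => bE /=.
  by move/negbT; rewrite negb_or => /andP[_ ->]; rewrite (fsubsetP sEA _ bE) orbT.
move=> <- /and3P[_ /hasPn h _]; have := h b.
by rewrite orbF; case: (b \in drop k l) => [/(_ isT) /= /negbTE ->|_] //=; rewrite orbF.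
Qed.

Lemma nth_block_add A E C t : E `<=` A -> t <= #|` C `\` E| ->
  nth fset0 (A :: block A E C) (#|` A `\` E| + t)
    = fill E (left_to_right (C `\` E)) t.
Proof.
move=> sEA; case: t => [|t] tc.
  by rewrite addn0 nth_block_remove // subnn !fill0.
rewrite /block addnS /= nth_cat size_scanl size_rev size_left_to_right.
rewrite ltnNge leq_addr /= addKn nth_scanl ?size_left_to_right //.
by apply/fsetP=> b; rewrite in_foldl_add in_fill.
Qed.

End Strips.

(** * Blocks and standardization *)

Section Blocks.
Local Open Scope nat_scope.

Definition same_step (A B C : diagram) : bool :=
  [|| [&& covers A B, covers B C & nE (diff_box A B) (diff_box B C)],
      [&& covers B A, covers C B & nE (diff_box B C) (diff_box A B)]
    | covers B A && covers B C].

Lemma same_blockE O j :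
  same_block O j.+2
    = same_step (nth fset0 O j) (nth fset0 O j.+1) (nth fset0 O j.+2).
Proof. by []. Qed.

(** * Recovering two strips from a chain of moves in one block *)

Section OfChain.
Variables (g : nat -> diagram) (m : nat).
Hypothesis gc : forall t, t < m -> covers (g t) (g t.+1) || covers (g t.+1) (g t).
Hypothesis gs : forall t, t.+1 < m -> same_step (g t) (g t.+1) (g t.+2).

(** None of (a), (b), (c) lets a deletion follow an addition, so the deletions come first; [d] is
    their number. *)
Lemma chain_valley : exists d, [/\ d <= m,
  forall t, t < d -> covers (g t.+1) (g t)
  & forall t, d <= t < m -> covers (g t) (g t.+1)].
Proof.
elim: m gc gs => [|p IH] hc hs; first by exists 0; split=> // t; rewrite andbF.
have [t tp|t tp|d [dp hd ha]] := IH; [exact/hc/ltnW|exact/hs/ltnW|].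
have [dp'|dp'] := ltnP d p.
  exists d; split=> // [|t /andP[dt]]; first exact: ltnW.
  rewrite ltnS leq_eqVlt => /orP[/eqP tp|tp]; last by rewrite ha ?dt.
  case: p dp' tp ha hs {IH hc dp} => // p dp' -> ha /(_ p (ltnSn _)).
  have /covers_asym : covers (g p) (g p.+1) by apply: ha; rewrite ltnSn andbT.
  by rewrite /same_step => -> /=; rewrite orbF => /and3P[].
have {dp dp'}Ed : d = p by lia.
case/orP: (hc p (ltnSn _)) => hp.
  exists d; split=> // [|t]; first by rewrite Ed.
  by rewrite Ed => tp; have -> : t = p by lia.
exists p.+1; split=> // [t|t]; last by lia.
by rewrite ltnS leq_eqVlt => /orP[/eqP->|tp] //; apply: hd; rewrite Ed.
Qed.

(* The lowest diagram of the chain is located by counting boxes: m moves lead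
   from [g 0] to [g m], so the number of deletions is determined. *)
Lemma chain_block (d := (#|` g 0| + m - #|` g m|)./2) :
  [/\ g d `<=` g 0, g d `<=` g m,
      horizontal_strip (g 0 `\` g d) & horizontal_strip (g m `\` g d)]
  /\ [/\ #|` g 0 `\` g d| + #|` g m `\` g d| = m, d <= m
    & forall t, t <= m -> nth fset0 (g 0 :: block (g 0) (g d) (g m)) t = g t].
Proof.
have [e [em hd ha]] := chain_valley.
(* Read backwards from the lowest diagram, the deletions are a chain of additions, and (b) becomes
   the order that [chain_fill] requires. *)
have [] := @chain_fill (fun t => g (e - t)) e.
- move=> t te; have -> : e - t = (e - t.+1).+1 by lia.
  by apply: hd; lia.
- move=> t te; have -> : e - t = (e - t.+2).+2 by lia.
  have -> : e - t.+1 = (e - t.+2).+1 by lia.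
  set u := e - t.+2.
  have /gs : u.+1 < m by lia.
  have /hd/covers_asym cu : u < e by lia.
  have /hd/covers_asym cu' : u.+1 < e by lia.
  rewrite /same_step cu cu' !(andbF, orbF) /= => /and3P[_ _].
  by rewrite diff_boxC (diff_boxC (g u)).
rewrite subn0 subnn size_left_to_right => s1 h1 z1 f1.
have [] := @chain_fill (fun t => g (e + t)) (m - e).
- by move=> t te; rewrite addnS; apply: ha; lia.
- move=> t te; rewrite !addnS.
  have /gs : (e + t).+1 < m by lia.
  have /covers_asym cu : covers (g (e + t)) (g (e + t).+1) by apply: ha; lia.
  by rewrite /same_step cu /= orbF => /and3P[].
rewrite addn0 subnKC // size_left_to_right => s2 h2 z2 f2.
have Ed : d = e.
  rewrite /d; have := z1; have := z2; rewrite !cardfsDS //.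
  have := fsubset_leq_card s1; have := fsubset_leq_card s2.
  move=> ? ? ? ?; have -> : #|` g 0| + m - #|` g m| = e.*2 by lia.
  by rewrite doubleK.
rewrite Ed; split; split=> //; first by rewrite z1 z2 subnKC.
move=> t tm; have [te|te] := leqP t e.
  by rewrite nth_block_remove ?z1 // -f1 ?leq_subr // subKn.
have Et : t = #|` g 0 `\` g e| + (t - e) by rewrite z1 subnKC // ltnW.
rewrite [in LHS]Et nth_block_add ?z2 ?leq_sub2r //.
by rewrite -f2 ?leq_sub2r // subnKC // ltnW.
Qed.

End OfChain.

(** * Conversely, the chain of moves defined by two horizontal strips *)

Section OfStrips.
Variables A E C : diagram.
Hypotheses (pA : is_partition A) (pE : is_partition E) (pC : is_partition C).
Hypotheses (sEA : E `<=` A) (sEC : E `<=` C).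
Hypotheses (hA : horizontal_strip (A `\` E)) (hC : horizontal_strip (C `\` E)).
Let g t := nth fset0 (A :: block A E C) t.
Let r := #|` A `\` E|.
Let c := #|` C `\` E|.

Lemma block_partition t : t <= r + c -> is_partition (g t).
Proof.
move=> tm; rewrite /g; have [tr|tr] := leqP t r.
  by rewrite nth_block_remove //; apply: fill_partition.
rewrite -(subnKC (ltnW tr)) nth_block_add //; first exact: fill_partition.
by rewrite /c in tm; lia.
Qed.

Lemma block_remove t : t < r ->
  covers (g t.+1) (g t)
  /\ diff_box (g t) (g t.+1) = nth (0, 0) (left_to_right (A `\` E)) (r - t.+1).
Proof.
move=> tr; rewrite /g !nth_block_remove ?(ltnW tr) // -/r.
have -> : r - t = (r - t.+1).+1 by lia.
by rewrite diff_boxC fill_covers ?fill_diff_box // size_left_to_right -/r; lia.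
Qed.

Lemma block_add t : r <= t < r + c ->
  covers (g t) (g t.+1)
  /\ diff_box (g t) (g t.+1) = nth (0, 0) (left_to_right (C `\` E)) (t - r).
Proof.
case/andP=> rt tc; rewrite -(subnKC rt) -addnS addKn /g.
have tc' : t - r < c by lia.
rewrite !nth_block_add ?(ltnW tc') //.
by rewrite fill_covers ?fill_diff_box // size_left_to_right.
Qed.

Lemma block_step t : t < r + c -> covers (g t) (g t.+1) || covers (g t.+1) (g t).
Proof.
move=> tm; have [tr|tr] := ltnP t r; first by rewrite (proj1 (block_remove tr)) orbT.
by rewrite (proj1 (block_add _)) // tr.
Qed.

Lemma block_same_step t : t.+1 < r + c -> same_step (g t) (g t.+1) (g t.+2).
Proof.
move=> tm; rewrite /same_step.
have [tr|tr] := ltnP t.+1 r.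
  have [c1 ->] := block_remove (ltnW tr); have [c2 ->] := block_remove tr.
  rewrite c1 c2 /=; have -> : r - t.+1 = (r - t.+2).+1 by lia.
  by rewrite strip_nE ?orbT // size_left_to_right -/r; lia.
have c2 := @block_add t.+1; have [c21 c22] : _ /\ _ := c2 ltac:(by rewrite tr).
(* If the earlier move is the last deletion, the pair turns at [E] and falls under (c). *)
have [tr'|tr'] := ltnP t r.
  by rewrite (proj1 (block_remove tr')) c21 !orbT.
have [c11 c12] : _ /\ _ := @block_add t ltac:(by rewrite tr' ltnW).
rewrite c11 c21 c12 c22 /=; have -> : t.+1 - r = (t - r).+1 by lia.
by rewrite strip_nE // size_left_to_right -/c; lia.
Qed.

Lemma block_last : g (r + c) = C.
Proof.
by rewrite /g nth_block_add // -/c /c -size_left_to_right fill_size.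
Qed.

End OfStrips.
End Blocks.

(** * Weights as lengths of consecutive blocks *)

Section Standardization.
Local Open Scope nat_scope.

(** For weights vanishing at [0] this is [w_1 + ... + w_i], the time at which the [i]-th block
    ends. *)
Definition psum (w : nat -> nat) (i : nat) : nat := \sum_(a < i.+1) w a.

Lemma psum0 w : psum w 0 = w 0.
Proof. by rewrite /psum big_ord_recl big_ord0 addn0. Qed.

Lemma psumS w i : psum w i.+1 = psum w i + w i.+1.
Proof. by rewrite /psum big_ord_recr. Qed.

Lemma psum_pred w i : 0 < i -> psum w i = psum w i.-1 + w i.
Proof. by case: i => // i _; rewrite psumS. Qed.

Lemma psum_leq w i j : i <= j -> psum w i <= psum w j.
Proof.
move/subnKC <-; elim: (j - i) => [|d IH]; first by rewrite addn0.
by rewrite addnS psumS (leq_trans IH) // leq_addr.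
Qed.

Lemma psum_split w i : w 0 = 0 -> forall j, 0 < j <= psum w i ->
  exists a t, [/\ 0 < a <= i, 0 < t <= w a & j = psum w a.-1 + t].
Proof.
move=> w0 j; elim: i => [|i IH]; first by rewrite psum0 w0; lia.
have [ji|ji] := leqP j (psum w i).
  case/andP=> j0 _; have [|a [t [ai tw ->]]] := IH; first by rewrite j0.
  by exists a, t; split=> //; lia.
rewrite psumS => jw; exists i.+1, (j - psum w i); split=> //=; lia.
Qed.

Lemma psum_const w K i : (forall a, K < a -> w a = 0) -> K <= i -> psum w i = psum w K.
Proof.
move=> wK /subnKC <-; elim: (i - K) => [|d IH]; first by rewrite addn0.
by rewrite addnS psumS IH wK ?addn0 // ltnS leq_addr.
Qed.

(* S'^i is the lowest diagram of the i-th block, located as in [chain_block]. *)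
Definition destd (O : seq diagram) (w : nat -> nat) : tableau := fun i =>
  let A := nth fset0 O (psum w i.-1) in let C := nth fset0 O (psum w i) in
  (nth fset0 O (psum w i.-1 + (#|` A| + w i - #|` C|)./2), C).

(** [is_OT] with length and final shape prescribed, and moves indexed by their starting time. *)
Definition OT_to (lambda : diagram) (n : nat) (O : seq diagram) : Prop :=
  [/\ size O = n.+1, nth fset0 O 0 = fset0, nth fset0 O n = lambda,
      forall j, j <= n -> is_partition (nth fset0 O j)
    & forall j, j < n -> covers (nth fset0 O j) (nth fset0 O j.+1)
                         || covers (nth fset0 O j.+1) (nth fset0 O j)].

(** Every step of the [i]-th block except its first must continue the previous step; hence the range
    of [t]. *)
Definition compatible (O : seq diagram) (w : nat -> nat) : Prop :=
  forall i t, 0 < i -> 0 < t < w i -> same_block O (psum w i.-1 + t).+1.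

(** [std] with a free number of blocks in place of [step], for inductions on blocks. *)
Definition std_upto (S : tableau) (K : nat) : seq diagram :=
  fset0 :: flatten [seq block (S i.-1).2 (S i).1 (S i).2 | i <- iota 1 K].

Lemma std_uptoS S K :
  std_upto S K.+1 = std_upto S K ++ block (S K).2 (S K.+1).1 (S K.+1).2.
Proof.
by rewrite /std_upto -[K.+1 in LHS]addn1 iotaD map_cat flatten_cat /= add1n cats0.
Qed.

Lemma std_upto_const S K K' : (forall i, K < i -> mult S i = 0) -> K <= K' ->
  std_upto S K' = std_upto S K.
Proof.
move=> wK /subnKC <-; elim: (K' - K) => [|d IH]; first by rewrite addn0.
rewrite addnS std_uptoS IH -[RHS]cats0; congr (_ ++ _).
by apply: size0nil; rewrite size_block; apply: (wK _.+1); rewrite ltnS leq_addr.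
Qed.

(** * Standardization of a semistandard oscillating tableau *)

Section SSOT.
Variables (lambda : diagram) (S : tableau).
Hypothesis SS : is_SSOT S lambda.
Let w := mult S.

Lemma mult0 : w 0 = 0.
Proof.
by case: SS => -[e1 e2 e3] _ _ _; rewrite /w /mult /removed /added /= e1 e2 fsetDv cardfs0.
Qed.

Lemma mult_finite : exists N, forall i, N < i -> mult S i = 0.
Proof.
case: SS => _ _ _ [N hN]; exists N.+1 => -[|i] // Ni.
have [e1 e2] := hN i (ltnW Ni); have [e3 e4] := hN i.+1 (ltnW (ltnW Ni)).
by rewrite /mult /removed /added /= e1 e2 e3 fsetDv cardfs0.
Qed.

(** Finite support is what gives [step], [length] and [monomial] their intended values: a sum or
    product with infinite support defaults to the neutral element. *)
Lemma mult_support_finite : finite_set [set i | 0 < mult S i].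
Proof.
have [N hN] := mult_finite; apply: (@sub_finite_set _ _ `I_N.+1); last exact: finite_II.
by move=> i /= wi; rewrite ltnS leqNgt; apply: contraTN wi => /hN ->.
Qed.

Lemma leq_step i : 0 < mult S i -> i <= step S.
Proof.
move=> wi; rewrite /step fsbig_finite //=; last exact: mult_support_finite.
apply: (@leq_bigmax_seq _ _ xpredT id) => //.
by rewrite in_fset_set ?inE //; exact: mult_support_finite.
Qed.

Lemma mult_gt_step i : step S < i -> mult S i = 0.
Proof.
move=> si; apply/eqP; rewrite -leqn0 leqNgt.
by apply: contraL si => /leq_step; rewrite -leqNgt.
Qed.

Lemma step_leq k : (forall i, k < i -> mult S i = 0) -> step S <= k.
Proof.
move=> wk; rewrite /step fsbig_finite //=; last exact: mult_support_finite.
apply/bigmax_leqP_seq => i; rewrite in_fset_set ?inE; last exact: mult_support_finite.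
by move=> wi _; rewrite leqNgt; apply: contraL wi => /wk ->.
Qed.

Lemma std_uptoE K : step S <= K -> std S = std_upto S K.
Proof. by move=> sK; rewrite (std_upto_const mult_gt_step sK). Qed.

Lemma length_psum K : step S <= K -> length S = psum w K.
Proof.
move=> sK; rewrite /length /psum fsbig_ord; apply/esym/fsbig_widen => // i [_ /= /negP].
by rewrite -leqNgt => /(leq_ltn_trans sK)/mult_gt_step.
Qed.

(** Past [step S] both strips are empty, so all diagrams agree with the eventual value [lambda]. *)
Lemma SSOT_const i : step S <= i -> S i.+1 = (lambda, lambda) /\ (S i).2 = lambda.
Proof.
move=> si; suff e d : (S (i + d)).2 = (S i).2 /\ (S (i + d).+1).1 = (S i).2.
  case: SS => _ _ _ [N hN]; have [eN _] := hN _ (leq_addl i N).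
  have Si : (S i).2 = lambda by rewrite -eN; case: (e N).
  split=> //; rewrite [S i.+1]surjective_pairing -Si.
  by case: (e 0) (e 1) => _; rewrite addn0 addn1 => -> [->].
have e1 d' : (S (i + d').+1).1 = (S (i + d')).2 /\ (S (i + d').+1).2 = (S (i + d').+1).1.
  have /mult_gt_step /eqP : step S < (i + d').+1 by lia.
  rewrite addn_eq0 !cardfs_eq0 !fsetD_eq0 /= => /andP[s1 s2].
  case: SS => _ _ /(_ (i + d').+1 isT) [s1' s2' _ _] _.
  by split; apply/eqP; rewrite eqEfsubset ?s1 ?s1' ?s2 ?s2'.
elim: d => [|d [IH1 IH2]]; first by case: (e1 0); rewrite addn0.
by have [-> _] := e1 d.+1; have [e3 e4] := e1 d; rewrite addnS e4 e3.
Qed.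

Lemma std_upto_spec K : size (std_upto S K) = (psum w K).+1
  /\ nth fset0 (std_upto S K) (psum w K) = (S K).2.
Proof.
elim: K => [|K [IH1 IH2]].
  by rewrite psum0 mult0; split=> //; case: SS => -[_ -> _].
rewrite std_uptoS size_cat IH1 size_block psumS; split=> //.
case: SS => _ pS /(_ K.+1 isT) [s1 s2 h1 h2] _.
rewrite -[RHS](block_last s1 s2) nth_cat IH1 -/(mult S K.+1) -/w.
case: (posnP (w K.+1)) => w0; first by rewrite w0 addn0 ltnSn IH2.
rewrite ltnNge -addn1 leq_add2l w0 /= subnDl.
by case: (w K.+1) w0 => // m _; rewrite subn1.
Qed.

Lemma nth_std i t : 0 < i -> t <= w i ->
  nth fset0 (std S) (psum w i.-1 + t)
    = nth fset0 ((S i.-1).2 :: block (S i.-1).2 (S i).1 (S i).2) t.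
Proof.
(* Truncating at [i.+1 + step S] covers both all of [std S] and the block in question; the induction
   then discards later blocks. *)
case: i => // i _ tw; rewrite (@std_uptoE (i.+1 + step S)) ?leq_addl //.
elim: (step S) => [|d IH] /=.
  have [e1 e2] := std_upto_spec i.
  rewrite addn0 std_uptoS nth_cat e1; case: t tw => [|t] tw; first by rewrite addn0 ltnSn.
  by rewrite ltnNge -addn1 leq_add2l /= subnDl subn1.
rewrite addnS std_uptoS nth_cat; have [-> _] := std_upto_spec (i.+1 + d).
rewrite ltnS (leq_trans (leq_add (leqnn _) tw)) // -psumS psum_leq //.
exact: leq_addr.
Qed.

Lemma nth_std_psum i : nth fset0 (std S) (psum w i) = (S i).2.
Proof.
case: i => [|i]; first by rewrite psum0 mult0 //; case: SS => -[_ -> _].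
by have := @nth_std i.+2 0 isT isT; rewrite addn0.
Qed.

Lemma std_OT : OT_to lambda (length S) (std S).
Proof.
rewrite (length_psum (leqnn _)); have [e1 e2] := std_upto_spec (step S).
rewrite -std_uptoE // in e1 e2; split=> //.
- by rewrite e2; case: (SSOT_const (leqnn _)).
- case=> [|j] jn; first by case: SS => _ /(_ 0) [_ p0] _ _; case: SS p0 => -[_ -> _].
  have [|i [t [/andP[i0 _] /andP[_ tw] ->]]] := @psum_split w (step S) mult0 j.+1 => //.
  rewrite nth_std //; case: SS => _ pS /(_ i i0) [s1 s2 h1 h2] _.
  by apply: block_partition tw => //; [case: (pS i.-1)|case: (pS i)|case: (pS i)].
- move=> j jn; have [|i [[|t] [/andP[i0 _] /andP[t0 tw]]]] // := @psum_split w (step S) mult0 j.+1.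
  rewrite addnS => -[->]; rewrite -addnS !nth_std ?(ltnW tw) //.
  case: SS => _ pS /(_ i i0) [s1 s2 h1 h2] _.
  exact: block_step.
Qed.

Lemma std_compatible : compatible (std S) w.
Proof.
move=> i [|t] i0 // /andP[_ tw]; rewrite addnS same_blockE -!addnS.
rewrite !nth_std ?(ltnW tw) //; last exact/ltnW/ltnW.
case: SS => _ pS /(_ i i0) [s1 s2 h1 h2] _.
by apply: block_same_step => //; [case: (pS i.-1)|case: (pS i)|case: (pS i)].
Qed.

(** In each block the size of the first diagram, plus the weight, minus the size of the last, is
    twice the number of deletions. So [destd] looks up the diagram where the deletions end, which is
    [S'^i]. *)
Lemma stdK : destd (std S) w = S.
Proof.
apply/funext=> i; rewrite /destd !nth_std_psum [RHS]surjective_pairing; congr pair.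
case: i => [|i] /=.
  by rewrite psum0 mult0 addn0 subnn; case: SS => -[-> _ _].
case: SS => _ pS /(_ i.+1 isT) [s1 s2 h1 h2] _.
have Ew : w i.+1 = #|` (S i).2 `\` (S i.+1).1| + #|` (S i.+1).2 `\` (S i.+1).1| by [].
have c1 := cardfsDS s1; have c2 := cardfsDS s2; rewrite /= in c1.
have l1 := fsubset_leq_card s1; have l2 := fsubset_leq_card s2; rewrite /= in l1.
have -> : #|` (S i).2| + w i.+1 - #|` (S i.+1).2| = #|` (S i).2 `\` (S i.+1).1|.*2.
  rewrite Ew c1 c2 -addnn; move: l1 l2.
  move: #|` (S i).2| #|` (S i.+1).2| #|` (S i.+1).1| => x y z; lia.
rewrite doubleK (@nth_std i.+1) ?Ew ?leq_addr //.
by rewrite (nth_block_remove _ s1) ?subnn ?fill0.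
Qed.

End SSOT.

(** * Rebuilding a tableau from an oscillating tableau and a compatible weight *)

Section Destd.
Variables (lambda : diagram) (n K : nat) (O : seq diagram) (w : nat -> nat).
Hypothesis hO : OT_to lambda n O.
Hypotheses (w0 : w 0 = 0) (wK : forall i, K < i -> w i = 0) (wn : psum w K = n).
Hypothesis hw : compatible O w.
Let S := destd O w.

Lemma psum_leqn i : psum w i <= n.
Proof.
rewrite -wn; have [iK|Ki] := leqP i K; first exact: psum_leq.
by rewrite (psum_const wK (ltnW Ki)).
Qed.

Lemma destd_block i : 0 < i ->
  [/\ (S i).1 `<=` (S i.-1).2, (S i).1 `<=` (S i).2,
      horizontal_strip (removed S i) & horizontal_strip (added S i)]
  /\ [/\ mult S i = w i, is_partition (S i).1
    & block (S i.-1).2 (S i).1 (S i).2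
        = [seq nth fset0 O j | j <- iota (psum w i.-1).+1 (w i)]].
Proof.
case: hO => _ _ _ pO cO i0; have wi := psum_leqn i; rewrite (psum_pred w i0) in wi.
(* The lowest diagram of this chain is the one that [destd] selects. *)
have [] := @chain_block (fun t => nth fset0 O (psum w i.-1 + t)) (w i).
- by move=> t tw; rewrite addnS; apply: cO; apply: leq_trans wi; rewrite -addnS leq_add2l.
- by move=> t tw; rewrite !addnS -same_blockE -addnS; apply: hw.
rewrite addn0 -psum_pred //.
rewrite -[nth _ _ (psum w i.-1)]/((S i.-1).2) -[nth _ _ (psum w i)]/((S i).2).
set d := _./2; rewrite -[nth _ _ (_ + d)]/((S i).1) => -[s1 s2 h1 h2] [e dw f].
split=> //; split=> //; first exact: pO (leq_trans (leq_add (leqnn _) dw) wi).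
apply: (@eq_from_nth _ fset0); first by rewrite size_map size_iota size_block.
move=> t; rewrite size_block e => tw.
rewrite (nth_map 0) ?size_iota // nth_iota // addSnnS.
by have := f t.+1 tw.
Qed.

Lemma destd_mult i : mult S i = w i.
Proof.
case: i => [|i]; last by case: (@destd_block i.+1 isT) => _ [].
by rewrite /mult /removed /added /= psum0 w0 !addn0 subnn fsetDv cardfs0.
Qed.

Lemma destd_SSOT : is_SSOT S lambda.
Proof.
case: (hO) => sO O0 On pO cO; split.
- split; try by rewrite /S /destd /= ?psum0 ?w0 ?addn0 ?subnn.
  have [[s _ _ _] _] := @destd_block 1 isT; apply/eqP; rewrite -fsubset0.
  by move: s; rewrite /= psum0 w0 O0.
- move=> i; split; last by apply/pO/psum_leqn.
  case: i => [|i]; last by case: (@destd_block i.+1 isT) => _ [].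
  by rewrite /S /destd /= psum0 w0 !addn0 subnn; apply: pO.
- by move=> i /destd_block [].
(* Past [K] the weight is [0]: time stays at [n] and the halved count is [0]. *)
exists K => i Ki; rewrite /S /destd /= (psum_const wK Ki) wn On.
split=> //; rewrite (psum_const wK (leqW Ki)) wn On wK ?ltnS // addn0 subnn addn0 On.
by [].
Qed.

Lemma destd_std : std S = O.
Proof.
case: (hO) => sO O0 On pO cO.
have sK : step S <= K by apply: (step_leq destd_SSOT) => i /wK; rewrite destd_mult.
rewrite (std_uptoE destd_SSOT sK).
(* Each block replays the moves of [O] between two boundaries, so the truncations are initial
   segments of [O]. *)
have -> m : std_upto S m = [seq nth fset0 O j | j <- iota 0 (psum w m).+1].
  elim: m => [|m IH]; first by rewrite /std_upto /= psum0 w0 /= O0.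
  rewrite std_uptoS IH psumS -addSn iotaD map_cat add0n; congr (_ ++ _).
  by have [_ [_ _ <-]] := @destd_block m.+1 isT.
by rewrite wn -sO map_nth_iota0 // take_size.
Qed.

End Destd.
End Standardization.

(** * Compositions *)

Section Compositions.
Local Open Scope nat_scope.

(** Refinement of compositions will be tested by inclusion of their sets of partial sums; [0] and
    the total always belong. *)
Definition partial_sum (a : seq nat) (j : nat) : Prop := exists p, j = sumn (take p a).

Lemma splits_partial_sum a b j : splits a b -> partial_sum a j -> partial_sum b j.
Proof.
case=> bs [-> -> _] [p ->]; exists (size (flatten (take p bs))).
rewrite -[bs in take _ (flatten bs)](cat_take_drop p bs) flatten_cat.
by rewrite take_size_cat // sumn_flatten map_take.
Qed.

Lemma splits_sumn a b : splits a b -> sumn a = sumn b.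
Proof. by case=> bs [-> -> _]; rewrite sumn_flatten. Qed.

Lemma splits_size (a b : seq nat) : 0 \notin a -> splits a b -> size a <= size b.
Proof.
move=> a0 [bs [-> Ea _]]; move: a0; rewrite {}Ea size_map size_flatten /shape.
elim: bs => // s bs IH; rewrite /= in_cons negb_or => /andP[s0 /IH].
by case: s s0 => //= x s _; rewrite addSn ltnS => /leq_trans; apply; apply: leq_addl.
Qed.

Lemma splits_refl (a : seq nat) : 0 \notin a -> splits a a.
Proof.
move=> a0; exists [seq [:: x] | x <- a]; split=> //; first by rewrite flatten_seq1.
by rewrite -map_comp -[LHS]map_id; apply: eq_map => x /=; rewrite addn0.
Qed.

(** Induction on [a]: its first part [x] is a partial sum of [b], which cuts off the first piece;
    the remaining partial sums are translated by [x]. *)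
Lemma splits_of_partial_sums (a b : seq nat) : 0 \notin b -> sumn a = sumn b ->
  (forall j, partial_sum a j -> partial_sum b j) -> splits a b.
Proof.
elim: a b => [|x a IH] b b0 /= sab hab.
  exists [::]; split=> //; case: b b0 sab {hab} => // y b.
  by rewrite inE negb_or /=; case: y.
have [p xp] : partial_sum b x by apply: hab; exists 1; rewrite /= take0 addn0.
have := cat_take_drop p b => Eb.
have [||j [q jq]|bs [Ebs Ea nz]] := IH (drop p b).
- by apply: contra b0 => /mem_drop.
- by move: sab; rewrite -{1}Eb sumn_cat -xp => /addnI.
- have [r xr] : partial_sum b (x + j) by apply: hab; exists q.+1; rewrite /= jq.
  (* If [r < p], then [x + j] is at most [x], so [j = 0]. *)
  have [pr|rp] := leqP p r; last first.
    exists 0; rewrite take0 /=; apply/eqP; rewrite -leqn0 -(leq_add2l x) addn0 xr xp.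
    have -> : take r b = take r (take p b) by rewrite take_takel // ltnW.
    by rewrite -{2}(cat_take_drop r (take p b)) sumn_cat leq_addr.
  exists (r - p); apply/eqP; rewrite -(eqn_add2l x) xr xp.
  by rewrite take_drop subnK // -(take_takel b pr) -sumn_cat cat_take_drop.
exists (take p b :: bs); split=> //=; first by rewrite -Ebs.
by rewrite -Ea xp.
Qed.

(** * Partial sums of descent compositions and of weights *)

Lemma sumn_block_lengths c s : sumn (block_lengths c s) = c + size s.
Proof.
elim: s c => //= t s IH c; case: t => /=; rewrite IH; lia.
Qed.

Lemma block_lengths_gt0 c s : 0 < c -> 0 \notin block_lengths c s.
Proof.
elim: s c => [|t s IH] c c0 /=; first by rewrite inE eq_sym -lt0n.
by case: t; [exact: IH|rewrite inE negb_or eq_sym -lt0n c0 IH].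
Qed.

(** With [c] indices in the open block, entry [i] of [s] decides whether index [c + i + 1] joins its
    predecessor; a false entry is a cut at [c + i]. *)
Lemma partial_sum_block_lengths c s i : 0 < c -> i < size s ->
  partial_sum (block_lengths c s) (c + i) <-> ~~ nth true s i.
Proof.
(* The first block has length at least [d]. *)
have low d r j : 0 < j < d -> ~ partial_sum (block_lengths d r) j.
  move=> jd [p]; suff : sumn (take p (block_lengths d r)) = 0
    \/ d <= sumn (take p (block_lengths d r)) by lia.
  elim: r d {jd} => [|t r IH] d /=; first by case: p => [|p] /=; [left|right; rewrite addn0].
  case: t; first by case: (IH d.+1) => ?; [left|right; apply: ltnW].
  by case: p IH => [|p] _ /=; [left|right; rewrite leq_addr].
elim: s c i => // t s IH c [|i] c0 /= si; case: t => /=.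
- by split=> //; rewrite addn0 => /low; case; rewrite c0 leqnn.
- by split=> // _; exists 1; rewrite /= take0 !addn0.
- by rewrite addnS -addSn; apply: IH.
have := IH 1 i isT si; rewrite add1n => -[IH1 IH2].
split=> [|/IH2] -[].
  case=> [|p] /=; first by lia.
  by move/addnI=> e; apply: IH1; exists p.
by move=> p e; exists p.+1; rewrite /= -e.
Qed.

Lemma des_nonnil O : 1 < size O ->
  des O = block_lengths 1 [seq same_block O j | j <- iota 2 (size O).-2].
Proof. by case: O => [|? [|? ?]]. Qed.

Lemma sumn_des O : sumn (des O) = (size O).-1.
Proof.
rewrite /des; case: ifP => [/eqP -> //|]; move/negbT.
by rewrite sumn_block_lengths size_map size_iota -lt0n; lia.
Qed.

Lemma des_gt0 O : 0 \notin des O.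
Proof. by rewrite /des; case: ifP => // _; apply: block_lengths_gt0. Qed.

Lemma partial_sum_des O j : 0 < j < (size O).-1 ->
  partial_sum (des O) j <-> ~~ same_block O j.+1.
Proof.
case: j => // j jO; rewrite des_nonnil; last by lia.
rewrite -add1n partial_sum_block_lengths // ?size_map ?size_iota; last by lia.
by rewrite (nth_map 0) ?size_iota ?nth_iota ?add2n //; lia.
Qed.

Definition nonzero_parts (w : nat -> nat) (K : nat) : seq nat :=
  [seq x <- [seq w i | i <- iota 1 K] | x != 0].

Lemma nonzero_parts_gt0 w K : 0 \notin nonzero_parts w K.
Proof. by rewrite mem_filter. Qed.

Lemma nonzero_partsS w K :
  nonzero_parts w K.+1 = nonzero_parts w K ++ [seq x <- [:: w K.+1] | x != 0].
Proof. by rewrite /nonzero_parts -[K.+1 in LHS]addn1 iotaD map_cat filter_cat. Qed.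

Section Weights.
Variables (w : nat -> nat) (K : nat).
Hypothesis w0 : w 0 = 0.

Lemma sumn_nonzero_parts i : sumn (nonzero_parts w i) = psum w i.
Proof.
elim: i => [|i IH]; first by rewrite psum0 w0.
by rewrite nonzero_partsS sumn_cat IH psumS /=; case: (w _) => //= m; rewrite addn0.
Qed.

(** Dropping the zeros of [w] removes only repetitions among its partial sums. *)
Lemma partial_sum_nonzero_parts j :
  partial_sum (nonzero_parts w K) j <-> exists2 i, i <= K & j = psum w i.
Proof.
split=> [[p ->]|[i iK ->]].
  elim: K => [|m [i im e]]; first by exists 0; rewrite // psum0 w0 take_oversize.
  have [pm|mp] := leqP p (size (nonzero_parts w m)).
    by exists i; [exact: leqW|rewrite nonzero_partsS takel_cat].
  exists m.+1 => //; rewrite take_oversize ?sumn_nonzero_parts //.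
  rewrite nonzero_partsS size_cat /=; case: ifP => _ /=; lia.
exists (size (nonzero_parts w i)); rewrite -sumn_nonzero_parts.
by rewrite /nonzero_parts -(subnKC iK) iotaD map_cat filter_cat take_size_cat.
Qed.

(** The partial sums of [des O] strictly between [0] and the total are the times where a block must
    end. Compatibility says that all of them are boundaries of [w], which is refinement. *)
Lemma compatibleP O : (forall i, K < i -> w i = 0) -> size O = (psum w K).+1 ->
  compatible O w <-> splits (des O) (nonzero_parts w K).
Proof.
move=> wK sO; have sumO : sumn (des O) = psum w K by rewrite sumn_des sO.
split=> [hw|hs i t i0 /andP[t0 tw]].
  apply: splits_of_partial_sums; [exact: nonzero_parts_gt0|by rewrite sumO sumn_nonzero_parts|].
  move=> j pj; have [j0|j0] := posnP j; first by exists 0; rewrite take0.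
  have jn : j <= psum w K.
    by case: pj => p ->; rewrite -sumO -{2}(cat_take_drop p (des O)) sumn_cat leq_addr.
  apply/partial_sum_nonzero_parts.
  have [ej|nj] := eqVneq j (psum w K); first by exists K.
  have [|a [t [/andP[a0 aK] /andP[t0 tw] ej]]] := @psum_split w K w0 j; first by rewrite j0.
  exists a => //; rewrite (psum_pred _ a0) ej.
  have [//|tn] := eqVneq t (w a); first by move->.
  (* A cut strictly inside block [a] contradicts compatibility. *)
  have : ~~ same_block O j.+1.
    by apply/partial_sum_des => //; rewrite sO j0 /= ltn_neqAle nj.
  by rewrite ej (hw _ _ a0) // t0 ltn_neqAle tn.
(* A break inside block [i] would be a partial sum of [des O], hence some [psum w a]; but no
   boundary lies strictly between two consecutive ones. *)
apply: contraT; have iK : i <= K by rewrite leqNgt; apply/negP=> /wK; lia.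
have e := psum_pred w i0; have l := psum_leq w iK.
move/(partial_sum_des (O := O)) => /(_ ltac:(rewrite sO /=; lia)).
move=> /(splits_partial_sum hs) /partial_sum_nonzero_parts [a aK ea].
have [ai|ia] := ltnP a i.
  have : psum w a <= psum w i.-1 by apply: psum_leq; lia.
  by rewrite -ea; lia.
by have := psum_leq w ia; rewrite -ea e; lia.
Qed.

End Weights.

Definition des_weight (O : seq diagram) (i : nat) : nat :=
  if i is i'.+1 then nth 0 (des O) i' else 0.

Lemma nonzero_parts_des_weight O :
  nonzero_parts (des_weight O) (size (des O)) = des O.
Proof.
rewrite /nonzero_parts (iotaDl 1 0) -map_comp.
rewrite (@eq_map _ _ _ (nth 0 (des O))) // map_nth_iota0 // take_size.
by apply/all_filterP/allP => x; apply: contraTneq => ->; apply: des_gt0.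
Qed.

Lemma des_weight_oversize O i : size (des O) < i -> des_weight O i = 0.
Proof. by case: i => // i si; apply: nth_default. Qed.

End Compositions.

(** * Generating functions *)

(** [B] may be infinite: only finitely many fibers meet [A], so the outer sum reduces to the image
    of [A] and the two finite sums are exchanged. *)
Lemma fsbig_fibers (R : Type) (idx : R) (op : Monoid.com_law idx)
    (I J : choiceType) (A : set I) (B : set J) (f : I -> J) (F : I -> R) :
    finite_set A -> (forall x, A x -> B (f x)) ->
  \big[op/idx]_(x \in A) F x
    = \big[op/idx]_(y \in B) \big[op/idx]_(x \in A `&` f @^-1` [set y]) F x.
Proof.
move=> finA fAB; set r : seq I := fset_set A; set s := undup [seq f x | x <- r].
have rA x : (x \in r) = (x \in A) by rewrite /r in_fset_set.
have -> : \big[op/idx]_(y \in B) \big[op/idx]_(x \in A `&` f @^-1` [set y]) F x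
    = \big[op/idx]_(y <- s) \big[op/idx]_(x <- r | f x == y) F x.
  rewrite [RHS](@fsbig_seq _ _ op) ?undup_uniq //.
  pose G y := \big[op/idx]_(x \in A `&` f @^-1` [set y]) F x.
  rewrite -[LHS]/(\big[op/idx]_(y \in B) G y) -(@fsbig_widen _ _ _ op [set` s] B).
  - apply: eq_fsbigr => y _; rewrite /G -[RHS]big_filter.
    rewrite [RHS](@fsbig_seq _ _ op) ?filter_uniq ?fset_uniq //.
    apply: eq_fsbigl; apply/seteqP; split=> x /=.
      by case=> Ax <-; rewrite mem_filter eqxx rA inE.
    by rewrite mem_filter => /andP[/eqP <-]; rewrite rA inE.
  - by move=> y /=; rewrite mem_undup => /mapP[x]; rewrite rA inE => /fAB + ->.
  - move=> y [By /= /negP ys]; apply: fsbig1 => x [Ax /= fx].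
    by case: ys; rewrite -fx mem_undup map_f // rA inE.
rewrite fsbig_finite // (exchange_big_dep xpredT) //= -/r.
rewrite big_seq [RHS]big_seq; apply: eq_bigr => x xr.
rewrite -big_filter; set t := [seq _ <- _ | _].
suff -> : t = [:: f x] by rewrite big_seq1.
have : perm_eq t [:: f x].
  apply: uniq_perm; rewrite ?filter_uniq ?undup_uniq // => y.
  rewrite mem_filter mem_seq1; apply/andP/eqP => [[/eqP ->]|->] //.
  by split; rewrite ?mem_undup ?map_f //; apply/eqP.
by move/perm_small_eq; apply.
Qed.

(** * Tableaux of bounded step and their weights *)

Section Sums.
Variables (lambda : diagram) (n k : nat).

Definition bounded_SSOT : set tableau := [set S | SSOT lambda n S /\ (step S <= k)%N].

(** The [i + 1] boxes weakly above [(i, j)] in its column and the [j + 1] weakly left of it in its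
    row all lie in [D]. *)
Lemma partition_bound (D : diagram) i j : is_partition D -> (i, j) \in D ->
  (i < #|` D|)%N /\ (j < #|` D|)%N.
Proof.
move=> pD ijD; split.
  have := @uniq_leq_size _ [seq (a, j) | a <- iota 0 i.+1] (enum_fset D).
  rewrite size_map size_iota; apply; first by rewrite map_inj_uniq ?iota_uniq // => a b [].
  by move=> _ /mapP[a ai ->]; apply: pD ijD _ _ => //; move: ai; rewrite mem_iota; lia.
have := @uniq_leq_size _ [seq (i, b) | b <- iota 0 j.+1] (enum_fset D).
rewrite size_map size_iota; apply; first by rewrite map_inj_uniq ?iota_uniq // => a b [].
by move=> _ /mapP[b bj ->]; apply: pD ijD _ _ => //; move: bj; rewrite mem_iota; lia.
Qed.

Lemma OT_card O m mu j : OT_to mu m O -> (j <= m)%N -> (#|` nth fset0 O j| <= j)%N.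
Proof.
case=> _ O0 _ _ cO; elim: j => [|j IH] jm; first by rewrite O0 cardfs0.
have := IH (ltnW jm); case/orP: (cO j jm) => /andP[_ /eqP]; lia.
Qed.

(** All diagrams fit in an [n] by [n] square, and past index [k] the tableau is constantly [lambda],
    so [k + 1] pairs of subsets of the square determine it. *)
Lemma bounded_SSOT_finite : finite_set bounded_SSOT.
Proof.
pose B : diagram := [fset p in [seq (a, b) | a <- iota 0 n, b <- iota 0 n]].
pose P := fpowerset B.
pose g (phi : {ffun 'I_k.+1 -> P * P}) : tableau := fun i =>
  if insub i is Some j then (val (phi j).1, val (phi j).2) else (lambda, lambda).
apply: (@sub_finite_set _ _ (range g)); last exact/finite_image/finite_finset.
move=> S [[SS lS] sS].
have S2 i : (#|` (S i).2| <= n)%N.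
  rewrite -(nth_std_psum SS).
  have wi : (psum (mult S) i <= n)%N.
    rewrite -lS (length_psum SS (leq_addl i _)).
    by apply: psum_leq; rewrite leq_addr.
  by apply: (leq_trans (OT_card (std_OT SS) _) wi); rewrite lS.
have inP D : is_partition D -> (#|` D| <= n)%N -> D \in P.
  move=> pD Dn; rewrite fpowersetE; apply/fsubsetP => -[i j] /(partition_bound pD) [iD jD].
  by rewrite !inE; apply/allpairsP; exists (i, j); split=> //=; rewrite mem_iota; lia.
case: (SS) => -[e1 e2 e3] pS sub _.
have S12 i : (S i).1 `<=` (S i).2.
  by case: i => [|i]; [rewrite e1 e2|case: (sub i.+1 isT)].
have P1 i : (S i).1 \in P.
  by apply: inP; [case: (pS i)|apply: leq_trans (S2 i); apply: fsubset_leq_card].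
have P2 i : (S i).2 \in P by apply: inP; [case: (pS i)|].
exists [ffun j : 'I_k.+1 => ([` P1 j], [` P2 j])] => //.
apply/funext => i; rewrite /g; case: insubP => [j _ <-|].
  by rewrite ffunE /= -surjective_pairing.
case: i => // i; rewrite ltnS -ltnNge ltnS => ki.
by have [-> _] := SSOT_const SS (leq_trans sS ki).
Qed.

(** The exponents of [x_{i_1}^{b_1} ... x_{i_l}^{b_l}]. For [a] outside [i], [index] returns
    [size i], and [nth] its default [0] when the sizes agree. *)
Definition weight_of (b i : seq nat) (a : nat) : nat := nth 0%N b (index a i).

Definition support_upto (w : nat -> nat) : seq nat := [seq a <- iota 1 k | w a != 0%N].

Lemma nonzero_partsE w : nonzero_parts w k = [seq w a | a <- support_upto w].
Proof. by rewrite /nonzero_parts filter_map. Qed.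

Lemma support_upto_sorted w : path ltn 0%N (support_upto w).
Proof.
rewrite path_min_sorted ?sorted_filter ?iota_ltn_sorted //; first exact: ltn_trans.
by apply/allP => a; rewrite mem_filter mem_iota => /and3P[].
Qed.

Lemma weight_of_support w : w 0%N = 0%N -> (forall a, (k < a)%N -> w a = 0%N) ->
  weight_of (nonzero_parts w k) (support_upto w) = w.
Proof.
move=> w0 wk; apply/funext => a; rewrite /weight_of nonzero_partsE.
have [ai|ai] := boolP (a \in support_upto w).
  by rewrite (nth_map 0%N) ?index_mem // nth_index.
rewrite nth_default ?size_map; last by rewrite leqNgt index_mem.
apply/esym/eqP; move: ai; apply: contraR => wa; rewrite mem_filter wa mem_iota add1n ltnS.
rewrite lt0n /=; apply/andP; split; first by apply: contraNneq wa => ->; rewrite w0.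
by rewrite leqNgt; apply: contra wa => /wk ->.
Qed.

Section WeightOf.
Variables b i : seq nat.
Hypotheses (si : size i = size b) (b0 : 0%N \notin b).
Hypotheses (pi : path ltn 0%N i) (ik : all (fun a => a <= k)%N i).
Let w := weight_of b i.

Lemma weight_of_eq0 a : (w a == 0%N) = (a \notin i).
Proof.
rewrite /w /weight_of; have [ai|ai] := boolP (a \in i).
  by apply: contraNF b0 => /eqP <-; rewrite mem_nth // -si index_mem.
by rewrite nth_default ?eqxx // -si leqNgt index_mem.
Qed.

Lemma weight_of0 : w 0%N = 0%N.
Proof.
apply/eqP; rewrite weight_of_eq0; apply/negP.
by move: pi => /(order_path_min ltn_trans) /allP h /h.
Qed.

Lemma weight_of_gt a : (k < a)%N -> w a = 0%N.
Proof.
move=> ka; apply/eqP; rewrite weight_of_eq0; apply: contraL ka => /(allP ik).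
by rewrite -leqNgt.
Qed.

Lemma support_weight_of : support_upto w = i.
Proof.
apply: (irr_sorted_eq ltn_trans ltnn).
- exact/path_sorted/support_upto_sorted.
- exact: path_sorted pi.
move=> a; rewrite mem_filter weight_of_eq0 negbK mem_iota add1n ltnS.
case/boolP: (a \in i) => // ai; rewrite (allP ik) // andbT.
by move: pi => /(order_path_min ltn_trans) /allP ->.
Qed.

Lemma weight_of_nth j : (j < size b)%N -> w (nth 0%N i j) = nth 0%N b j.
Proof.
move=> jb; rewrite /w /weight_of index_uniq ?si //.
exact: sorted_uniq ltn_trans ltnn _ (path_sorted pi).
Qed.

Lemma nonzero_parts_weight_of : nonzero_parts w k = b.
Proof.
rewrite nonzero_partsE support_weight_of.
apply: (@eq_from_nth _ 0%N); rewrite size_map // => j ji.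
by rewrite (nth_map 0%N) // weight_of_nth // -si.
Qed.

End WeightOf.

Lemma monomial_weight (R : comNzRingType) (x : nat -> R) S b (i : (size b).-tuple nat) :
    0%N \notin b -> path ltn 0%N i -> mult S =1 weight_of b i ->
  monomial S x = \prod_(j < size b) x (tnth i j) ^+ nth 0%N b j.
Proof.
move=> b0 pi wS; have si : size i = size b by rewrite size_tuple.
have ui : uniq i by apply: sorted_uniq ltn_trans ltnn _ (path_sorted pi).
rewrite /monomial -(@fsbig_widen _ _ _ _ [set` (i : seq nat)]) //; last first.
  move=> a [_ /= /negP ai]; apply/eqP.
  by have := weight_of_eq0 si b0 a; rewrite -wS ai => /eqP ->.
rewrite -fsbig_seq // big_tuple; apply: eq_bigr => j _.
by rewrite wS (tnth_nth 0%N) weight_of_nth // -?size_tuple.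
Qed.

(** * Tableaux with a prescribed standardization *)

Section Fiber.
Variable O : seq diagram.
Hypothesis hO : OT_to lambda n O.

Definition fiber : set tableau := bounded_SSOT `&` [set S | std S = O].

Lemma destd_fiber w : w 0%N = 0%N -> (forall a, (k < a)%N -> w a = 0%N) ->
    splits (des O) (nonzero_parts w k) ->
  fiber (destd O w) /\ mult (destd O w) = w.
Proof.
move=> w0 wk hs; have [sO _ _ _ _] := hO.
have wn : psum w k = n.
  by rewrite -(sumn_nonzero_parts w0) -(splits_sumn hs) sumn_des sO.
have hw : compatible O w by apply/(compatibleP w0 wk); rewrite ?wn.
have SS := destd_SSOT hO w0 wk wn hw.
have mE : mult (destd O w) = w by apply/funext => a; apply: (destd_mult hO w0 wk wn hw).
have sk : (step (destd O w) <= k)%N by apply: (step_leq SS) => a; rewrite mE; apply: wk.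
split=> //; split; last exact: (destd_std hO w0 wk wn hw).
by split=> //; split=> //; rewrite (length_psum SS sk) mE.
Qed.

Lemma fiber_splits S : fiber S -> splits (des O) (nonzero_parts (mult S) k).
Proof.
case=> -[[SS lS] sS] <-; have [sO _ _ _ _] := std_OT SS.
rewrite (length_psum SS sS) in sO.
have wk a : (k < a)%N -> mult S a = 0%N.
  by move=> ka; apply: (mult_gt_step SS) (leq_ltn_trans sS ka).
exact: (proj1 (compatibleP (mult0 SS) wk sO)) (std_compatible SS).
Qed.

Lemma destd_weight_of b (i : (size b).-tuple nat) : splits (des O) b ->
    path ltn 0%N i -> all (fun a => a <= k)%N i ->
  fiber (destd O (weight_of b i)) /\ mult (destd O (weight_of b i)) = weight_of b i.
Proof.
move=> hs pi ik; have b0 : 0%N \notin b by case: hs => bs [].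
have si : size i = size b by rewrite size_tuple.
apply: destd_fiber; [exact: weight_of0|exact: weight_of_gt|].
by rewrite nonzero_parts_weight_of.
Qed.

(** A tableau over [O] is determined by its weight, by [stdK], and a weight with nonzero parts [b]
    by its support. *)
Lemma fiber_bij b : splits (des O) b ->
  set_bij [set i : (size b).-tuple nat | path ltn 0%N i /\ all (fun a => a <= k)%N i]
    (fiber `&` [set S | nonzero_parts (mult S) k = b])
    (fun i => destd O (weight_of b i)).
Proof.
move=> hs; have b0 : 0%N \notin b by case: hs => bs [].
have hdes := destd_weight_of hs.
split.
- move=> i [pi ik]; have [fi mi] := hdes _ pi ik; split=> //=.
  by rewrite mi nonzero_parts_weight_of // size_tuple.
- move=> i j; rewrite !inE => -[pi ik] [pj jk] e.
  have [_ mi] := hdes _ pi ik; have [_ mj] := hdes _ pj jk.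
  apply: val_inj; rewrite /= -(support_weight_of _ b0 pi ik) ?size_tuple //.
  by rewrite -[RHS](support_weight_of _ b0 pj jk) ?size_tuple // -mi -mj e.
move=> S [fS /= Sb]; have [[[SS lS] sS] Se] := fS.
have si : size (support_upto (mult S)) == size b by rewrite -Sb nonzero_partsE size_map.
exists (Tuple si) => /=.
  split; first exact: support_upto_sorted.
  by apply/allP => a; rewrite mem_filter mem_iota add1n ltnS => /and3P[].
rewrite -{1}Sb weight_of_support ?(mult0 SS) //; last first.
  by move=> a ka; apply: (mult_gt_step SS) (leq_ltn_trans sS ka).
by rewrite -Se (stdK SS).
Qed.

(** Grouping the fiber by the nonzero parts [b] of the weight, [fiber_bij] turns each group into
    [M x b]. *)
Lemma F_fiber (R : comNzRingType) (x : nat -> R) :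
    (forall a, (k < a)%N -> x a = 0) ->
  F x (des O) = \sum_(S \in fiber) monomial S x.
Proof.
move=> xk; rewrite (@fsbig_fibers _ _ _ _ _ fiber [set b | splits (des O) b]
  (fun S => nonzero_parts (mult S) k)); first last.
- by move=> S /fiber_splits.
- exact: finite_setIl bounded_SSOT_finite.
apply: eq_fsbigr => b; rewrite inE => hs; have b0 : 0%N \notin b by case: hs => bs [].
rewrite (reindex_fsbig _ _ _ _ (fiber_bij hs)).
rewrite /M -(@fsbig_widen _ _ _ _
  [set i : (size b).-tuple nat | path ltn 0%N i /\ all (fun a => a <= k)%N i]).
- apply: eq_fsbigr => i; rewrite inE => -[pi ik]; apply/esym/monomial_weight => // a.
  by have [_ ->] := destd_weight_of hs pi ik.
- by move=> i [].
(* A tuple with an index [a] above [k] contributes [0]: [x a] vanishes and its exponent, a part of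
   [b], is positive. *)
move=> i [/= pi]; rewrite not_andP => -[//|/negP]; rewrite -has_predC => /hasP[a ai /=].
rewrite -ltnNge => ka; have [j aj] : exists j, a = tnth i j by apply/tnthP.
rewrite (bigD1 j) //= -aj xk // expr0n; case: eqP => [e|]; last by rewrite mul0r.
by move: b0; rewrite -e mem_nth.
Qed.

End Fiber.

(** The weight of [S] refines [des O] and has at most [k] nonzero parts, so [des O] has at most [k]
    parts and is itself an admissible weight. *)
Lemma destd_des_QYOT S (O := std S) : bounded_SSOT S ->
  QYOT k n lambda (destd O (des_weight O)) /\ std (destd O (des_weight O)) = O.
Proof.
move=> hS; have [[SS lS] sS] := hS; have hO := std_OT SS; rewrite lS -/O in hO.
have hs : splits (des O) (nonzero_parts (mult S) k) by apply: fiber_splits.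
have sdk : (size (des O) <= k)%N.
  apply: leq_trans (splits_size (des_gt0 O) hs) _.
  by rewrite size_filter (leq_trans (count_size _ _)) // size_map size_iota.
have [||[[SO sO] e] mE] := @destd_fiber O hO (des_weight O) (erefl _).
- by move=> a ka; apply: des_weight_oversize; apply: leq_ltn_trans ka.
- have -> : nonzero_parts (des_weight O) k = des O; last exact/splits_refl/des_gt0.
  rewrite -[RHS]nonzero_parts_des_weight /nonzero_parts -(subnKC sdk) iotaD map_cat filter_cat.
  rewrite -[RHS]cats0; congr (_ ++ _); apply/eqP; rewrite -[_ == _]negbK -has_filter.
  apply/hasPn => x /mapP[a + ->].
  by rewrite mem_iota add1n => /andP[/des_weight_oversize -> _].
by split=> //; split=> // a; rewrite mE e.
Qed.

(** The weight of [Q] is read off [std Q], so [stdK] recovers [Q] from [std Q] alone. *)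
Lemma QYOT_bounded Q : QYOT k n lambda Q ->
  [/\ bounded_SSOT Q, OT_to lambda n (std Q) & destd (std Q) (des_weight (std Q)) = Q].
Proof.
move=> [[SQ lQ] yQ sQ]; split=> //; first by rewrite -lQ; apply: std_OT.
rewrite -[RHS](stdK SQ); congr destd; apply/funext => -[|a] /=; last by rewrite yQ.
by rewrite (mult0 SQ).
Qed.

(** A tableau of step above [k] has a factor [x a = 0] with positive exponent. *)
Lemma ss_bounded (R : comNzRingType) (x : nat -> R) :
    (forall a, (k < a)%N -> x a = 0) ->
  ss x lambda n = \sum_(S \in bounded_SSOT) monomial S x.
Proof.
move=> xk; apply/esym/fsbig_widen => [S []//|S [hS /= nS]].
have [SS _] := hS; have [a ka Sa] : exists2 a, (k < a)%N & (0 < mult S a)%N.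
  apply: contrapT => h; apply: nS; split=> //; apply: (step_leq SS) => a ka.
  by apply/eqP; rewrite -leqn0 leqNgt; apply/negP => Sa; apply: h; exists a.
have fin := mult_support_finite SS.
rewrite /monomial -(@fsbig_widen _ _ _ _ [set i | (0 < mult S i)%N]) //.
  by rewrite (fsbigD1 a) //= xk // expr0n; case: eqP Sa => [->|] //; rewrite mul0r.
by move=> b [_ /= /negP]; rewrite -eqn0Ngt => /eqP ->.
Qed.


Lemma ss_QYOT (R : comNzRingType) (x : nat -> R) :
    (forall a, (k < a)%N -> x a = 0) ->
  ss x lambda n = \sum_(Q \in QYOT k n lambda) F x (des (std Q)).
Proof.
move=> xk; rewrite ss_bounded //.
rewrite (@fsbig_fibers _ _ _ _ _ bounded_SSOT (QYOT k n lambda)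
  (fun S => destd (std S) (des_weight (std S)))); first last.
- by move=> S /destd_des_QYOT [].
- exact: bounded_SSOT_finite.
apply: eq_fsbigr => Q; rewrite inE => /QYOT_bounded [bQ hQ eQ].
(* Two tableaux have the same quasi-Yamanouchi image exactly when their standardizations agree. *)
rewrite (F_fiber hQ xk); apply: eq_fsbigl; apply/seteqP; split=> S [bS /= e]; split=> //=.
  by have [_ <-] := destd_des_QYOT bS; rewrite e.
by rewrite e eQ.
Qed.

End Sums.

(** * Specialization to [k] variables and nonvanishing *)

Lemma xvar_oversize k a : (k < a)%N -> xvar k a = 0.
Proof. by case: a => // a ka; rewrite /xvar insubN // -leqNgt. Qed.

Lemma xvar_eval1 k a : (0 < a <= k)%N -> (xvar k a).@[fun=> 1] = 1.
Proof. by case: a => // a ak; rewrite /xvar insubT mevalXU. Qed.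

Lemma monomial_eval1 lambda n k S : bounded_SSOT lambda n k S ->
  (monomial S (xvar k)).@[fun=> 1] = 1.
Proof.
move=> [[SS _] sS]; rewrite /monomial rmorph_prod big1 // => a _; rewrite rmorphXn /=.
have [->|wa] := posnP (mult S a); first by rewrite expr0.
rewrite xvar_eval1 ?expr1n // (leq_trans (leq_step SS wa) sS) andbT lt0n.
by apply: contraTneq wa => ->; rewrite (mult0 SS).
Qed.

(* At [x_1 = ... = x_k = 1] the polynomial counts the tableaux of its fiber,
   among which [Q] itself. *)
Lemma F_QYOT_neq0 lambda n k Q : QYOT k n lambda Q -> F (xvar k) (des (std Q)) != 0.
Proof.
move=> /QYOT_bounded [bQ hQ _]; rewrite (F_fiber hQ (@xvar_oversize k)).
set A := fiber _ _ _ _; have finA : finite_set A.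
  exact: finite_setIl (bounded_SSOT_finite _ _ _).
have AQ : A Q by split.
rewrite fsbig_finite //; apply/eqP => /(congr1 (meval (fun=> 1))).
rewrite meval0 raddf_sum /= big_seq (eq_bigr (fun=> 1)); last first.
  by move=> S; rewrite in_fset_set // inE => -[bS _]; apply: monomial_eval1 bS.
(* The value is the size of the fiber as an integer, hence nonzero once the fiber is nonempty. *)
rewrite -big_seq big_const_seq count_predT iter_addr_0.
apply/eqP; rewrite Num.Theory.pnatr_eq0 -lt0n -has_predT.
by apply/hasP; exists Q => //; rewrite in_fset_set ?inE.
Qed.

Theorem theorem2p26 (lambda : diagram) (n k : nat)
    (hlambda : is_partition lambda)
    (hn : (#|` lambda| <= n)%N) (hpar : (n = #|` lambda| %[mod 2])%N)
    (hk : (1 <= k)%N) :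
  ss (xvar k) lambda n
    = \sum_(Q \in QYOT k n lambda) F (xvar k) (des (std Q))
  /\ forall Q : tableau, QYOT k n lambda Q -> F (xvar k) (des (std Q)) != 0.
Proof.
split; first exact/ss_QYOT/xvar_oversize.
by move=> Q; apply: F_QYOT_neq0.
Qed.
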